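(* Let $\mathbb{F}_q$ be a finite field of characteristic at least five, let $\sigma\in\mathbb{F}_q$ be a nonsquare, and let $n>1$ be an integer. If $q\equiv 1\pmod 3$, then \[ |\mathcal{I}(x^3+3\sigma x,\,3x^2+\sigma,\,n,\,q)|=\frac{1}{3n_3}\Bigl(I\bigl(n/(2n_3),q^{2n_3}\bigr)-I\bigl(n/(2n_3),1\bigr)\Bigr). \] If $q\equiv -1\pmod 3$, then \[ |\mathcal{I}(x^3+3\sigma x,\,3x^2+\sigma,\,n,\,q)|=\frac{2}{3n_3}\Bigl(I\bigl(n/n_3,q^{n_3}\bigr)-I\bigl(n/n_3,-1\bigr)\Bigr). \]
   Context: For coprime $g,h\in\mathbb{F}_q[x]$ and an integer $n>1$, $\mathcal{I}(g,h,n,q)$ denotes the set of monic irreducible polynomials $f\in\mathbb{F}_q[x]$ of degree $n$ such that $h(x)^n f\bigl(g(x)/h(x)\bigr)$ is irreducible in $\mathbb{F}_q[x]$. $n_3$ denotes the largest power of $3$ dividing $n$. For a positive integer $k$ and any integer $Q$ (not necessarily a prime power, possibly negative), $I(k,Q)=\frac1k\sum_{d\mid k}\mu(d)Q^{k/d}$, where $\mu$ is the Möbius function; $I(k,Q)=0$ by convention when $k$ is not a positive integer. *)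

(* Defs.v *)
From HB Require Import structures.
From mathcomp Require Import all_boot all_order all_algebra all_field.
From mathcomp Require Import ring.

Set Implicit Arguments.
Unset Strict Implicit.
Unset Printing Implicit Defensive.

Import Order.TTheory GRing.Theory Num.Theory.
Local Open Scope ring_scope.

Local Notation "x %:F" := (@tofrac _ x) : ring_scope.

(* The polynomial h^n f(g/h) for f of degree at most n, with denominators
   cleared; ratsubst_tofrac identifies it with h^n f(g/h) computed in F(x). *)
Definition ratsubst (F : fieldType) (g h : {poly F}) (n : nat) (f : {poly F}) :
    {poly F} :=
  \sum_(i < n.+1) f`_i *: (g ^+ i * h ^+ (n - i)).

Lemma ratsubst_tofrac (F : fieldType) (g h : {poly F}) (n : nat) (f : {poly F}) :
    h != 0 -> (size f <= n.+1)%N ->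
  (ratsubst g h n f)%:F =
    h%:F ^+ n * (map_poly (@tofrac {poly F} \o polyC) f).[g%:F / h%:F].
Proof.
move=> h0 sf; rewrite (horner_coef_wide (n := n.+1)); last first.
  by apply: leq_trans sf; apply: size_poly.
rewrite mulr_sumr /ratsubst rmorph_sum; apply: eq_bigr => i _ /=.
have h'0 : h%:F != 0 by rewrite tofrac_eq0.
rewrite coef_map /= -mul_polyC !rmorphM /= !rmorphXn /=.
rewrite expr_div_n [RHS]mulrCA; congr (_ * _).
rewrite [RHS]mulrCA; congr (_ * _).
by rewrite expfB_cond // (negPf h'0) add0n -ltnS.
Qed.

(* Only meaningful for coprime g and h. Degree-n polynomials live in the finite
   type of polynomials of size at most n.+1, and irreducibleb reflects
   irreducible_poly (irreducibleP). *)
Definition irr_transforms (F : finFieldType) (g h : {poly F}) (n : nat) :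
    {set {poly_(n.+1) F}} :=
  [set f : {poly_(n.+1) F} |
     [&& polyn f \is monic, size (polyn f) == n.+1, irreducibleb (polyn f)
       & irreducibleb (ratsubst g h n (polyn f))]].

Definition cubic_num (F : fieldType) (s : F) : {poly F} :=
  'X^3 + (3%:R * s) *: 'X.

Definition cubic_den (F : fieldType) (s : F) : {poly F} :=
  3%:R *: 'X^2 + s%:P.

Lemma coprimep_cubic (F : fieldType) (s : F) :
  2%:R != 0 :> F -> s != 0 -> coprimep (cubic_num s) (cubic_den s).
Proof.
move=> two0 s0; apply/coprimepP => d dg dh.
have c0 : 8%:R * s ^+ 2 != 0.
  by rewrite mulf_neq0 ?expf_neq0 // (natrX F 2 3) expf_neq0.
have dc : d %| (8%:R * s ^+ 2)%:P.
  have -> : (8%:R * s ^+ 2)%:P =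
      ((8%:R * s)%:P + 3%:R *: 'X^2) * cubic_den s - (9%:R *: 'X) * cubic_num s.
    rewrite /cubic_den /cubic_num -!mul_polyC.
    by rewrite !(rmorphM, rmorphXn, rmorph_nat) /=; ring.
  by rewrite dvdp_sub // dvdp_mull.
have := dvdp_leq _ dc; rewrite polyC_eq0 => /(_ c0); rewrite size_polyC c0 => sd.
rewrite -size_poly_eq1 eqn_leq sd lt0n size_poly_eq0.
by apply: contraTneq dc => ->; rewrite dvd0p polyC_eq0.
Qed.

(* The Moebius function, intended for d > 0. *)
Definition moebius (d : nat) : int :=
  if all (fun p => logn p d == 1%N) (primes d) then (-1) ^+ size (primes d)
  else 0.

(* k ranges over rat so that the value 0 at k not a positive integer is part
   of the definition. *)
Definition necklace (k : rat) (Q : int) : rat :=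
  if (k \is a Num.nat) && (0 < k) then
    k^-1 * \sum_(d <- divisors (Num.truncn k))
             (moebius d * Q ^+ (Num.truncn k %/ d))%:~R
  else 0.

(* Main.v *)
From HB Require Import structures.
Require Import Defs.
From mathcomp Require Import all_boot all_order all_algebra all_field.
From mathcomp Require Import ring zify.
Import GRing.Theory Num.Theory.
Local Open Scope ring_scope.

(** Let tau be a square root of sigma in an algebraic closure K of F, and
let q = #|F|. The cubic map g/h with g = x^3 + 3 sigma x and h = 3 x^2 + sigma
satisfies g +- tau h = (x +- tau)^3, so in the coordinate
z = (x - tau) / (x + tau) it is the cubing map z |-> z^3. As sigma is not a
square in F, the Frobenius map sends tau to - tau, hence reads in that same
coordinate as phi : z |-> z^(-q).

A monic polynomial over F is irreducible of degree d exactly when its roots in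
K form one Frobenius orbit of length d ([irr_orbit_poly], [irr_of_period]).
So f of degree n and its transform h^n f(g/h), of degree 3n, are both
irreducible exactly when a root z of the transform, in the new coordinate, has
phi-period 3n while z^3 has phi-period n. Call E_n the set of these z
([triples]). Each f accounts for 3n of them, so the number N_n of such f
satisfies 3 n N_n = #|E_n| ([count_triples]).

The sets E_n are counted by sieving. For k > 0 let B_k be the set of z such that
phi^k fixes z^3 but not z ([newly_fixed]). The z <> 0 fixed by phi^k are the
roots of unity of order dividing q^k - (-1)^k, so #|B_k| = 2 (q^k - (-1)^k)
([count_newly_fixed]). Let z be in B_k, and let d be the period of z^3, a
divisor of k. Then phi^d z = w z with w <> 1 a cube root of unity. If phi^d
fixes w, then phi^(jd) z = w^j z for all j; thus z has period 3d, which puts z in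
E_d, and phi^k z <> z says that 3 does not divide k/d. This is always so when
phi fixes the cube roots of unity, that is, when q = -1 mod 3. When phi inverts
them, that is, when q = 1 mod 3, it is so for even d, whereas for odd d already
phi^(2d) z = z, which cannot happen for even k. Put s = 1 in the first case and
s = 2 in the second: for s dividing k, each z in B_k lies in E_d for exactly one
d, and this d is a multiple of s ([newly_fixed_triples]). If k = s 3^a e with e
prime to 3, the d that occur are the s 3^a d' with d' dividing e, so that
2 (q^k - (-1)^k) is the sum of the #|E_d| over these d ([sum_triples]). Moebius
inversion in e isolates #|E_n|, and the terms q^k and (-1)^k give the two
necklace sums of the statement. If q = 1 mod 3 and n is odd then E_n is empty
([triples_dvd]), and the right-hand side vanishes because n / (2 n_3) is not an
integer. *)

Set Implicit Arguments.
Unset Strict Implicit.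
Unset Printing Implicit Defensive.

(** * Least periods of a self-map *)
Section Period.
Variables (T : eqType) (phi : T -> T).

(** A boolean for [d is the least positive period of x], on a type that may be
infinite and for a map that may fail to be bijective. *)
Definition has_period (d : nat) (x : T) : bool :=
  [&& (0 < d)%N, iter d phi x == x
    & all (fun e => iter e phi x != x) (iota 1 d.-1)].

Lemma iter_fix_mul m d x : iter d phi x = x -> iter (m * d) phi x = x.
Proof. by move=> dx; elim: m => // m IH; rewrite mulSn iterD IH. Qed.

Lemma has_period_gt0 d x : has_period d x -> (0 < d)%N.
Proof. by case/and3P. Qed.

Lemma has_period_dvd d x n :
  has_period d x -> (iter n phi x == x) = (d %| n)%N.
Proof.
case/and3P=> d0 /eqP dx /allP min_d.
apply/eqP/idP => [|/dvdnP[m ->]]; last exact: iter_fix_mul.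
rewrite {1}(divn_eq n d) addnC iterD iter_fix_mul // /dvdn => nx.
apply: contraPT nx => r0; apply/eqP/min_d.
by rewrite mem_iota lt0n r0 add1n prednK // ltn_pmod.
Qed.

Lemma has_periodP d x : (0 < d)%N ->
  reflect (forall n, (iter n phi x == x) = (d %| n)%N) (has_period d x).
Proof.
move=> d0; apply: (iffP idP) => [hd n|hd]; first exact: has_period_dvd.
rewrite /has_period d0 hd dvdnn; apply/allP => e.
rewrite mem_iota add1n prednK // => /andP[e0 ed].
by rewrite hd gtnNdvd.
Qed.

Lemma has_period_uniq d e x : has_period d x -> has_period e x -> d = e.
Proof.
move=> hd he; apply/eqP; rewrite eqn_dvd.
by rewrite -(has_period_dvd _ hd) -(has_period_dvd _ he)
  (has_period_dvd _ he) (has_period_dvd _ hd) !dvdnn.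
Qed.

Lemma ex_has_period n x : (0 < n)%N -> iter n phi x = x ->
  exists d, has_period d x.
Proof.
move=> n0 nx; have ex : exists m, (0 < m)%N && (iter m phi x == x).
  by exists n; rewrite n0 nx eqxx.
case: (ex_minnP ex) => d /andP[d0 dx] min_d; exists d.
rewrite /has_period d0 dx; apply/allP => e.
rewrite mem_iota add1n prednK // => /andP[e0 ed].
by apply: contraTN ed => ex0; rewrite -leqNgt min_d ?e0.
Qed.

Lemma iter_inj i : injective phi -> injective (iter i phi).
Proof. by move=> inj; elim: i => //= i IH x y /inj /IH. Qed.

Lemma has_period_iter d x i : injective phi ->
  has_period d (iter i phi x) = has_period d x.
Proof.
move=> inj; case: (posnP d) => [->|d0]; first by rewrite /has_period.
have E n : (iter n phi (iter i phi x) == iter i phi x) = (iter n phi x == x).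
  by rewrite -iterD addnC iterD (inj_eq (iter_inj (i := i) inj)).
by apply/(has_periodP _ d0)/(has_periodP _ d0) => H n; 
  [rewrite -E H|rewrite E H].
Qed.

Lemma traject_uniq d x : injective phi -> has_period d x ->
  uniq (traject phi x d).
Proof.
move=> inj hd; have d0 := has_period_gt0 hd.
apply/(uniqP x) => i j; rewrite !inE size_traject => id jd.
rewrite !nth_traject //; wlog ij : i j id jd / (i <= j)%N => [W E|].
  by case/orP: (leq_total i j) => ?; [|apply/esym]; apply: W.
rewrite -(subnKC ij) iterD => /(iter_inj inj) /esym/eqP.
rewrite (has_period_dvd _ hd) => dv; case: (posnP (j - i)) => [->|ji0].
  by rewrite addn0.
by have := dvdn_leq ji0 dv; lia.
Qed.

End Period.

(** Injectivity of [u] is only asked along the orbit of [x]: the conjugating map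
used below is injective away from its pole. *)
Lemma has_period_conj (T U : eqType) (phi : T -> T) (psi : U -> U) (u : T -> U)
    d x :
  (forall n, u (iter n phi x) = iter n psi (u x)) ->
  (forall n, u (iter n phi x) = u x -> iter n phi x = x) ->
  has_period psi d (u x) = has_period phi d x.
Proof.
move=> H inj; case: (posnP d) => [->|d0]; first by rewrite /has_period.
have E n : (iter n psi (u x) == u x) = (iter n phi x == x).
  by rewrite -H; apply/eqP/eqP => [/inj|->].
by apply/(has_periodP _ _ d0)/(has_periodP _ _ d0) => h n; 
  [rewrite -E h|rewrite E h].
Qed.

(** * Moebius inversion *)
Section Moebius.

Lemma moebiusM_prime p d : prime p -> ~~ (p %| d)%N -> (0 < d)%N ->
  moebius (p * d) = - moebius d.
Proof.
move=> pp pd d0; have p0 := prime_gt0 pp.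
have pr : perm_eq (primes (p * d)) (p :: primes d).
  apply: uniq_perm; rewrite /= ?primes_uniq ?andbT //.
    by rewrite mem_primes negb_and negb_and pd !orbT.
  by move=> r; rewrite primesM // primes_prime // !inE.
rewrite /moebius (perm_size pr) (perm_all _ pr) /=.
rewrite lognM // logn_prime // eqxx lognE (negPf pd) !andbF /=.
rewrite (@eq_in_all _ _ (fun r => logn r d == 1)%N); last first.
  move=> r; rewrite mem_primes => /and3P[rp _ rd].
  rewrite lognM // (logn_prime _ pp); case: (eqVneq r p) => // rp'.
  by move: pd; rewrite -rp' rd.
by case: ifP; rewrite ?oppr0 // exprS mulN1r.
Qed.

Lemma moebius_sq p d : prime p -> (1 < logn p d)%N -> moebius d = 0.
Proof.
move=> pp pd; rewrite /moebius; case: allP => // H.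
have := H p; rewrite -logn_gt0 (ltn_trans _ pd) // => /(_ isT) /eqP E.
by rewrite E in pd.
Qed.

(** For the least prime p dividing n > 1, the divisors d prime to p cancel
against the divisors p * d, and those divisible by p^2 contribute nothing. *)
Lemma sum_moebius n : (0 < n)%N ->
  \sum_(d <- divisors n) moebius d = (n == 1)%N%:R.
Proof.
move=> n0; case: eqP => [->|/eqP n1]; first by rewrite big_seq1.
have pp : prime (pdiv n) by apply: pdiv_prime; lia.
set p := pdiv n in pp; have p0 := prime_gt0 pp.
rewrite (bigID (fun d => p %| d)%N) /=.
rewrite (bigID (fun d => logn p d == 1)%N) /= [X in _ + X + _]big1_seq; last first.
  move=> d /andP[/andP[pd l1]]; rewrite -dvdn_divisors // => dn.
  apply: (moebius_sq pp); rewrite ltn_neqAle eq_sym l1 logn_gt0 mem_primes.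
  by rewrite pp (dvdn_gt0 n0) // pd.
rewrite addr0 -big_filter -[X in _ + X]big_filter.
set A := [seq d <- _ | _]; set B := [seq d <- _ | _].
suff AB : perm_eq A [seq (p * d)%N | d <- B].
  rewrite (perm_big _ AB) big_map /= -big_split big1_seq //= => d.
  rewrite mem_filter -dvdn_divisors // => /andP[pd dn].
  by rewrite moebiusM_prime // ?addNr // (dvdn_gt0 n0).
apply: uniq_perm; first by rewrite filter_uniq // divisors_uniq.
  rewrite map_inj_uniq ?filter_uniq ?divisors_uniq // => x y /eqP.
  by rewrite eqn_pmul2l // => /eqP.
move=> d; rewrite mem_filter -dvdn_divisors //; apply/idP/mapP.
  case/andP=> /andP[/dvdnP[k ->] l1] dn; exists k; last by rewrite mulnC.
  have k0 : (0 < k)%N by have := dvdn_gt0 n0 dn; case: (k).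
  rewrite mem_filter -dvdn_divisors // (dvdn_trans _ dn) ?dvdn_mulr // andbT.
  move: l1; rewrite lognM // (logn_prime _ pp) eqxx.
  rewrite -[X in _ == X]add0n eqn_add2r => /eqP l0.
  by have := logn_gt0 p k; rewrite mem_primes pp k0 l0 /= => <-.
case=> k; rewrite mem_filter -dvdn_divisors // => /andP[pk kn] ->.
have k0 := dvdn_gt0 n0 kn.
rewrite dvdn_mulr //= lognM // logn_prime // eqxx lognE (negPf pk) !andbF eqxx /=.
by rewrite Gauss_dvd ?prime_coprime // kn pdiv_dvd.
Qed.

Lemma big_divisors_dvd (R : nmodType) (f : nat -> R) k m : (0 < m)%N ->
  (k %| m)%N ->
  \sum_(d <- divisors m | (d %| k)%N) f d = \sum_(d <- divisors k) f d.
Proof.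
move=> m0 km; have k0 := dvdn_gt0 m0 km; rewrite -big_filter; apply: perm_big.
apply: uniq_perm; rewrite ?filter_uniq ?divisors_uniq // => d.
rewrite mem_filter -!dvdn_divisors //; case: (boolP (d %| k)%N) => // dk.
by rewrite (dvdn_trans dk).
Qed.

Lemma moebius_inversion (a G : nat -> int) m : (0 < m)%N ->
  (forall e, (e %| m)%N -> G e = \sum_(d <- divisors e) a d) ->
  a m = \sum_(d <- divisors m) moebius d * G (m %/ d)%N.
Proof.
move=> m0 H.
have sw d e : (d %| m -> e %| m -> (e %| m %/ d) = (d %| m %/ e))%N.
  by move=> dm em; rewrite !dvdn_divRL // mulnC.
transitivity (\sum_(d <- divisors m)
   \sum_(e <- divisors m | (e %| m %/ d)%N) moebius d * a e); last first.
  apply: eq_big_seq => d; rewrite -dvdn_divisors // => dm.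
  by rewrite -mulr_sumr big_divisors_dvd ?dvdn_div // H ?dvdn_div.
rewrite (exchange_big_dep xpredT) //=.
rewrite (eq_big_seq (fun e => (m %/ e == 1)%N%:R * a e)); last first.
  move=> e; rewrite -dvdn_divisors // => em.
  have me0 : (0 < m %/ e)%N.
    by rewrite divn_gt0 ?(dvdn_gt0 m0 em) //; apply: dvdn_leq.
  have <- := sum_moebius me0.
  rewrite mulr_suml -(big_divisors_dvd _ m0 (dvdn_div em)).
  rewrite [LHS]big_seq_cond [RHS]big_seq_cond; apply: eq_bigl => d.
  by rewrite -dvdn_divisors //; case: (boolP (d %| m)%N) => //= dm; rewrite sw.
rewrite (bigD1_seq m) ?divisors_uniq -?dvdn_divisors //= divnn m0 mul1r.
rewrite big1_seq ?addr0 // => e; rewrite -dvdn_divisors // => /andP[em dv].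
case: eqP => [E|]; last by rewrite mul0r.
by move: em; rewrite -(divnK dv) E mul1n eqxx.
Qed.
End Moebius.

(** * Irreducible polynomials over a finite field and Frobenius orbits *)
Section FrobeniusOrbits.
Variables (F : finFieldType) (K : closedFieldType) (iota : {rmorphism F -> K}).
Notation q := #|F|.
Notation "f ^i" := (map_poly iota f) (at level 2, format "f ^i").
Definition frobenius (x : K) : K := x ^+ q.
Notation frob := frobenius.

Lemma pchar_nat_card : [pchar K].-nat q.
Proof.
have [p pp pF] := finPcharP F.
have := pprimeChar_pgroup pF; rewrite /pgroup.pgroup cardsT /=; apply: sub_in_pnat.
by move=> r _ /eqP ->; apply: rmorph_pchar pF.
Qed.

Lemma frobD : {morph frob : x y / x + y}.
Proof. by move=> x y; rewrite /frobenius exprDn_pchar // pchar_nat_card. Qed.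

Lemma card_field_gt0 : (0 < q)%N.
Proof. by apply/card_gt0P; exists 0. Qed.

Lemma frob_is_zmod_morphism : zmod_morphism frob.
Proof.
move=> x y; apply: (addIr (frob y)); rewrite -frobD !subrK //.
Qed.

Lemma frob_is_monoid_morphism : monoid_morphism frob.
Proof. by split=> [|x y]; rewrite /frobenius ?expr1n ?exprMn. Qed.

#[local] HB.instance Definition _ := GRing.isZmodMorphism.Build K K frobenius
  frob_is_zmod_morphism.
#[local] HB.instance Definition _ := GRing.isMonoidMorphism.Build K K frobenius
  frob_is_monoid_morphism.

Lemma frob_inj : injective frob.
Proof. exact: fmorph_inj. Qed.

Lemma frob_iota a : frob (iota a) = iota a.
Proof. by rewrite /frobenius -rmorphXn expf_card. Qed.

(** The elements of F are q roots of X^q - X, hence all of them. *)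
Lemma frob_fixed x : frob x = x -> exists a, x = iota a.
Proof.
move=> fx; have /(congr1 (fun p => p^i.[x])) := finField_genPoly F.
rewrite rmorphB rmorphXn /= map_polyX rmorph_prod horner_prod.
rewrite !(hornerE, hornerXn) -/(frobenius x) fx subrr => /esym/eqP/prodf_eq0[a _].
rewrite rmorphB /= map_polyX map_polyC !hornerE subr_eq0 => /eqP ->.
by exists a.
Qed.

Lemma root_frob (f : {poly F}) x : root f^i x -> root f^i (frob x).
Proof.
rewrite /root => /eqP fx; apply/eqP.
have -> : f^i = map_poly frob f^i.
  by rewrite -map_poly_comp; apply: eq_map_poly => a /=; rewrite frob_iota.
by rewrite (horner_map frob) fx rmorph0.
Qed.

Lemma root_iter_frob (f : {poly F}) x n :
  root f^i x -> root f^i (iter n frob x).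
Proof. by move=> fx; elim: n => //= n; apply: root_frob. Qed.

(** The orbit of a root consists of roots, so it is finite; injectivity of the
Frobenius map makes it purely periodic. *)
Lemma root_has_period (f : {poly F}) x : f != 0 -> root f^i x ->
  exists d, has_period frob d x.
Proof.
move=> f0 fx; have f0' : f^i != 0 by rewrite map_poly_eq0.
have : ~~ uniq (traject frob x (size f)).
  apply/negP => /(max_poly_roots f0' _) H; apply: notF; move: H.
  rewrite size_traject size_map_poly ltnn; apply.
  by apply/allP => _ /trajectP[i _ ->]; apply: root_iter_frob.
move=> /(uniqPn x)[i [j [ij]]]; rewrite size_traject => jl.
rewrite !nth_traject // ?(ltn_trans ij) // -(subnKC (ltnW ij)) iterD.
move=> /(iter_inj frob_inj) /esym; apply: ex_has_period.
by rewrite subn_gt0.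
Qed.

(** The Frobenius map permutes the factors, so it fixes every coefficient. *)
Lemma orbit_poly d x : has_period frob d x ->
  exists f : {poly F}, f^i = \prod_(y <- traject frob x d) ('X - y%:P).
Proof.
move=> hd; set P := \prod_(_ <- _) _.
have fixP : map_poly frob P = P.
  rewrite rmorph_prod /P /=.
  under eq_bigr do rewrite rmorphB /= map_polyX map_polyC /=.
  rewrite -(big_map frob xpredT (fun y => 'X - y%:P)).
  (* With x added, both lists are x, frob x, ..., frob^d x, as frob^d x = x. *)
  apply: perm_big; rewrite -(perm_cons x).
  have -> : [seq frob y | y <- traject frob x d] = traject frob (frob x) d.
    by elim: d x {hd P} => //= d IH x; rewrite IH.
  rewrite -trajectS trajectSr perm_rcons.
  by have /eqP -> : iter d frob x == x by rewrite (has_period_dvd _ hd).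
pose f := \poly_(i < size P) odflt 0 [pick a | iota a == P`_i].
exists f; apply/polyP => i; rewrite coef_map coef_poly /=.
case: ltnP => [_|/(nth_default 0) -> /=]; last by rewrite rmorph0.
case: pickP => [a /eqP //|no_a].
have [a Pa] : exists a, P`_i = iota a.
  by apply: frob_fixed; rewrite -{2}fixP coef_map.
by have := no_a a; rewrite Pa eqxx.
Qed.

Lemma root_orbit_poly d x (f : {poly F}) : has_period frob d x ->
  f^i = \prod_(y <- traject frob x d) ('X - y%:P) -> root f^i x.
Proof.
move=> hd ->; rewrite root_prod_XsubC; apply/trajectP.
by exists 0%N => //; apply: has_period_gt0 hd.
Qed.

Lemma ex_root_map (p : {poly F}) : size p != 1%N -> exists x, root p^i x.
Proof. by move=> sp; apply/closed_rootP; rewrite size_map_poly. Qed.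

(** A nonconstant divisor has a root in the orbit, hence has the whole orbit as
roots, hence has full degree. *)
Lemma orbit_poly_irr d x (f : {poly F}) : has_period frob d x ->
  f^i = \prod_(y <- traject frob x d) ('X - y%:P) ->
  [/\ f \is monic, size f = d.+1 & irreducible_poly f].
Proof.
move=> hd Ef; have sf : size f = d.+1.
  by rewrite -(size_map_poly iota) Ef size_prod_XsubC size_traject.
have mf : f \is monic.
  by rewrite -(map_monic iota) Ef monic_prod_XsubC.
split=> //; split; first by rewrite sf; have := has_period_gt0 hd.
move=> g g1 gf; rewrite -dvdp_size_eqp // eqn_leq dvdp_leq ?monic_neq0 //= sf.
have g0 : g != 0 by apply: contraTneq gf => ->; rewrite dvd0p monic_neq0.
have g0' : g^i != 0 by rewrite map_poly_eq0.
have [y gy] := ex_root_map g1.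
have yx : y \in traject frob x d.
  rewrite -root_prod_XsubC -Ef -dvdp_XsubCl.
  by apply: (@dvdp_trans _ g^i); rewrite ?dvdp_XsubCl ?dvdp_map.
have hy : has_period frob d y.
  by case/trajectP: yx => i _ ->; rewrite (has_period_iter _ _ _ frob_inj).
have := max_poly_roots g0' _ (traject_uniq frob_inj hy).
rewrite size_traject size_map_poly; apply.
by apply/allP => _ /trajectP[i _ ->]; apply: root_iter_frob.
Qed.

Lemma irr_dvdp_root (f g : {poly F}) x : irreducible_poly f ->
  root f^i x -> root g^i x -> f %| g.
Proof.
move=> irf fx gx; apply: contraTT gx => fg.
have : coprimep f^i g^i by rewrite coprimep_map irreducible_poly_coprime.
by move/coprimep_root => /(_ x fx).
Qed.

(** [f] is associated to the polynomial of the orbit of [x], since both are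
irreducible and share a root. *)
Lemma irr_orbit_poly (f : {poly F}) x : irreducible_poly f -> root f^i x ->
  exists2 d, has_period frob d x & size f = d.+1 /\
   forall y, root f^i y = (y \in traject frob x d).
Proof.
move=> irf fx; have f0 := irredp_neq0 irf.
have [d hd] := root_has_period f0 fx; exists d => //.
have [g Eg] := orbit_poly hd; have [mg sg irg] := orbit_poly_irr hd Eg.
have gx := root_orbit_poly hd Eg.
have fg : f %= g.
  apply/andP; split; first exact: irr_dvdp_root irf fx gx.
  exact: irr_dvdp_root irg gx fx.
split; first by rewrite (eqp_size fg).
move=> y; rewrite -root_prod_XsubC -Eg; apply: eqp_root.
by rewrite eqp_map.
Qed.

(** The polynomial of the orbit of [x] divides [f] and has the same degree. *)
Lemma irr_of_period (f : {poly F}) x d : size f = d.+1 ->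
  root f^i x -> has_period frob d x -> irreducible_poly f.
Proof.
move=> sf fx hd.
have [g Eg] := orbit_poly hd; have [mg sg irg] := orbit_poly_irr hd Eg.
have gx := root_orbit_poly hd Eg.
have gf : g %= f.
  by rewrite -dvdp_size_eqp ?sf ?sg //; apply: irr_dvdp_root irg gx fx.
split; first by rewrite sf; have := has_period_gt0 hd.
move=> h h1 hf; have hg : h %| g by rewrite (eqp_dvdr _ gf).
exact: eqp_trans (apply_irredp irg h1 hg) gf.
Qed.

End FrobeniusOrbits.

(** * The cubic substitution *)
Section RatSubst.
Variable F : fieldType.

Lemma horner_ratsubst (g h f : {poly F}) n x : (size f <= n.+1)%N ->
  h.[x] != 0 -> (ratsubst g h n f).[x] = h.[x] ^+ n * f.[g.[x] / h.[x]].
Proof.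
move=> sf hx; rewrite /ratsubst horner_sum (horner_coef_wide _ sf) mulr_sumr.
apply: eq_bigr => i _; rewrite hornerZ hornerM !horner_exp expr_div_n [RHS]mulrCA.
congr (_ * _); rewrite [RHS]mulrCA; congr (_ * _).
by rewrite expfB_cond // (negPf hx) add0n -ltnS.
Qed.

(** At a zero of [h] only the term of index n survives, so that for coprime [g]
and [h] and [f] of degree n the transform has no root there. *)
Lemma horner_ratsubst_pole (g h f : {poly F}) n x :
  h.[x] = 0 -> (ratsubst g h n f).[x] = f`_n * g.[x] ^+ n.
Proof.
move=> hx; rewrite /ratsubst horner_sum big_ord_recr /= big1 ?add0r => [|i _].
  by rewrite hornerZ hornerM !horner_exp subnn mulr1.
by rewrite hornerZ hornerM !horner_exp hx expr0n subn_eq0 leqNgt ltn_ord !mulr0.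
Qed.

Lemma map_ratsubst (R : fieldType) (iota : {rmorphism F -> R})
    (g h f : {poly F}) n :
  map_poly iota (ratsubst g h n f) =
  ratsubst (map_poly iota g) (map_poly iota h) n (map_poly iota f).
Proof.
rewrite /ratsubst rmorph_sum; apply: eq_bigr => i _.
by rewrite /= map_polyZ rmorphM !rmorphXn /= coef_map.
Qed.

Lemma size_cubic_num (s : F) : size (cubic_num s) = 4%N.
Proof.
rewrite /cubic_num size_polyDl size_polyXn // (leq_ltn_trans (size_scale_leq _ _)) //.
by rewrite size_polyX.
Qed.

Lemma monic_cubic_num (s : F) : cubic_num s \is monic.
Proof.
apply/monicP; rewrite /cubic_num lead_coefDl ?lead_coefXn // size_polyXn.
by rewrite (leq_ltn_trans (size_scale_leq _ _)) // size_polyX.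
Qed.

Lemma size_cubic_numX (s : F) i : size (cubic_num s ^+ i) = (3 * i).+1.
Proof.
have g0 : (0 < size (cubic_num s ^+ i)%R)%N.
  by rewrite size_poly_gt0 expf_neq0 // monic_neq0 // monic_cubic_num.
by rewrite -(prednK g0) size_exp size_cubic_num.
Qed.

Lemma size_cubic_den (s : F) : (size (cubic_den s) <= 3)%N.
Proof.
rewrite /cubic_den (leq_trans (size_polyD _ _)) // geq_max.
rewrite (leq_trans (size_scale_leq _ _)) ?size_polyXn //.
by rewrite (leq_trans (size_polyC_leq1 _)).
Qed.

(** As g has degree 3 and h degree 2, the term g^n has the largest degree. *)
Lemma size_ratsubst_cubic (s : F) n (f : {poly F}) : f \is monic ->
  size f = n.+1 -> size (ratsubst (cubic_num s) (cubic_den s) n f) = (3 * n).+1.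
Proof.
move=> mf sf; rewrite /ratsubst big_ord_recr /= subnn mulr1.
have -> : f`_n = 1 by move/monicP: mf; rewrite lead_coefE sf.
rewrite scale1r addrC size_polyDl size_cubic_numX // ltnS.
apply: (leq_trans (size_sum _ _ _)); apply/bigmax_leqP => i _.
apply: (leq_trans (size_scale_leq _ _)); apply: (leq_trans (size_polyMleq _ _)).
rewrite size_cubic_numX.
have ab := size_poly_exp_leq (cubic_den s) (n - i).
have b3 := size_cubic_den s; have i_n := ltn_ord i.
have : (((size (cubic_den s)).-1 * (n - i)).+1 <= (2 * (n - i)).+1)%N.
  by rewrite ltnS leq_mul2r; apply/orP; right; lia.
by move: (_ ^+ _) (_ * _)%N ab => a b; lia.
Qed.

End RatSubst.

(** * The coordinate in which the cubic map is cubing *)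
Section Cayley.
Variables (F : finFieldType) (K : closedFieldType) (iota : {rmorphism F -> K}).
Variables (sigma : F) (tau : K).
Hypotheses (tau2 : tau ^+ 2 = iota sigma) (two_neq0 : 2%:R != 0 :> K).
Hypothesis sigma_nsq : ~ exists y : F, y ^+ 2 = sigma.
Notation "f ^i" := (map_poly iota f) (at level 2, format "f ^i").
Notation frob := (@frobenius F K).

Lemma tau_neq0 : tau != 0.
Proof.
apply: contra_not_neq sigma_nsq => t0; exists 0; apply: (fmorph_inj iota).
by rewrite -tau2 t0 !expr0n rmorph0.
Qed.

(** The Frobenius map permutes the square roots of sigma; it would only fix
[tau] if [tau] were in F. *)
Lemma frob_tau : frob tau = - tau.
Proof.
have : (frob tau) ^+ 2 == tau ^+ 2.
  by rewrite /frobenius exprAC tau2; apply/eqP/frob_iota.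
rewrite eqf_sqr => /orP[/eqP /(frob_fixed iota)[a Ea]|/eqP //].
by case: sigma_nsq; exists a; apply: (fmorph_inj iota); rewrite -tau2 Ea rmorphXn.
Qed.

(** z |-> z^(-q), made total by 0^-1 = 0. *)
Definition twisted_frob (z : K) : K := (frob z)^-1.
Notation phi := twisted_frob.

Lemma phi_inj : injective phi.
Proof. by move=> x y /invr_inj /(frob_inj iota). Qed.

Lemma phiM : {morph phi : x y / x * y}.
Proof. by move=> x y; rewrite /twisted_frob /frobenius exprMn invfM. Qed.

Lemma phi1 : phi 1 = 1.
Proof. by rewrite /twisted_frob /frobenius expr1n invr1. Qed.

Lemma phi0 : phi 0 = 0.
Proof.
by rewrite /twisted_frob /frobenius expr0n /= eqn0Ngt (card_field_gt0 F) invr0.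
Qed.

Lemma iter_phiM n : {morph iter n phi : x y / x * y}.
Proof. by elim: n => // n IH x y; rewrite !iterS IH phiM. Qed.

Lemma iter_phiX n k : {morph iter n phi : x / x ^+ k}.
Proof.
move=> x; elim: k => [|k IH]; last by rewrite !exprS iter_phiM IH.
by rewrite !expr0; elim: n => //= n ->; rewrite phi1.
Qed.

Lemma iter_phi_eq n x y : phi y = y -> (iter n phi x == y) = (x == y).
Proof.
move=> fy; have {1}<- : iter n phi y = y by elim: n => //= n ->.
by rewrite (inj_eq (iter_inj (i := n) phi_inj)).
Qed.

(** The inverse of x |-> (x - tau) / (x + tau). Its pole is z = 1, and z = 0
corresponds to x = tau. *)
Definition uncayley (z : K) : K := tau * (1 + z) / (1 - z).

(** With Z = z^q, conjugation by the Frobenius map gives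
- tau (1 + Z) / (1 - Z), which is tau (1 + 1/Z) / (1 - 1/Z). *)
Lemma frob_uncayley z : z != 0 -> z != 1 -> frob (uncayley z) = uncayley (phi z).
Proof.
move=> z0 z1; rewrite /uncayley /twisted_frob.
have fB : frob (1 - z) = 1 - frob z.
  by rewrite (frob_is_zmod_morphism iota) /frobenius expr1n.
have fD : frob (1 + z) = 1 + frob z.
  by rewrite (frobD iota) /frobenius expr1n.
have -> : frob (tau * (1 + z) / (1 - z)) = - tau * (1 + frob z) / (1 - frob z).
  rewrite -fB -fD -frob_tau /frobenius.
  by rewrite !exprMn exprVn.
have Z0 : frob z != 0 by rewrite expf_neq0.
have Z1 : 1 - frob z != 0 by rewrite -fB expf_neq0 // subr_eq0 eq_sym.
move: (frob z) Z0 Z1 => Z Z0 Z1; field.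
by rewrite Z0 Z1 -oppr_eq0 opprB Z1.
Qed.

Lemma iter_uncayley n z : z != 0 -> z != 1 ->
  uncayley (iter n phi z) = iter n frob (uncayley z).
Proof.
move=> z0 z1; elim: n => //= n <-.
by rewrite frob_uncayley // iter_phi_eq ?phi0 ?phi1.
Qed.

Lemma uncayley_inj z w : z != 1 -> w != 1 -> uncayley z = uncayley w -> z = w.
Proof.
move=> z1 w1; have z1' : 1 - z != 0 by rewrite subr_eq0 eq_sym.
have w1' : 1 - w != 0 by rewrite subr_eq0 eq_sym.
rewrite /uncayley => /eqP; rewrite eqr_div // => /eqP E.
have /eqP : 2%:R * tau * (z - w) = 0.
  transitivity (tau * (1 + z) * (1 - w) - tau * (1 + w) * (1 - z)); first by ring.
  by rewrite E subrr.
by rewrite !mulf_eq0 (negPf two_neq0) (negPf tau_neq0) subr_eq0 => /eqP.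
Qed.

Lemma has_period_uncayley d z : z != 0 -> z != 1 ->
  has_period frob d (uncayley z) = has_period phi d z.
Proof.
move=> z0 z1; apply: has_period_conj => [n|n]; first exact: iter_uncayley.
by apply: uncayley_inj; rewrite ?iter_phi_eq ?phi1.
Qed.

Lemma uncayleyK x : x != - tau -> uncayley ((x - tau) / (x + tau)) = x.
Proof.
move=> xt; have xt' : x + tau != 0 by rewrite addr_eq0.
have E : 1 - (x - tau) / (x + tau) = 2%:R * tau / (x + tau) by field.
rewrite /uncayley E; field.
by rewrite xt' two_neq0 tau_neq0.
Qed.

Lemma map_cubic_num : (cubic_num sigma)^i = cubic_num (iota sigma).
Proof.
by rewrite /cubic_num rmorphD /= map_polyXn map_polyZ /= map_polyX rmorphM rmorph_nat.
Qed.

Lemma map_cubic_den : (cubic_den sigma)^i = cubic_den (iota sigma).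
Proof.
by rewrite /cubic_den rmorphD /= map_polyZ /= map_polyXn map_polyC rmorph_nat.
Qed.

Lemma horner_cubic_num z : z != 1 -> (cubic_num sigma)^i.[uncayley z] =
  4%:R * tau ^+ 3 * (1 + z ^+ 3) / (1 - z) ^+ 3.
Proof.
move=> z1; rewrite map_cubic_num /cubic_num -tau2 hornerD hornerXn hornerZ hornerX.
by rewrite /uncayley; field; rewrite subr_eq0 eq_sym.
Qed.

Lemma horner_cubic_den z : z != 1 -> (cubic_den sigma)^i.[uncayley z] =
  4%:R * tau ^+ 2 * (1 - z ^+ 3) / (1 - z) ^+ 3.
Proof.
move=> z1; rewrite map_cubic_den /cubic_den -tau2 hornerD hornerZ hornerXn hornerC.
by rewrite /uncayley; field; rewrite subr_eq0 eq_sym.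
Qed.

Lemma four_neq0 : 4%:R != 0 :> K.
Proof. by rewrite (natrM K 2 2) mulf_neq0. Qed.

Lemma cubic_den_neq0 z : z != 1 ->
  ((cubic_den sigma)^i.[uncayley z] != 0) = (z ^+ 3 != 1).
Proof.
move=> z1; have z1' : 1 - z != 0 by rewrite subr_eq0 eq_sym.
rewrite horner_cubic_den // !mulf_eq0 invr_eq0 !expf_eq0 /=.
by rewrite (negPf four_neq0) (negPf tau_neq0) (negPf z1') orbF subr_eq0 eq_sym.
Qed.

Notation T n f := (ratsubst (cubic_num sigma) (cubic_den sigma) n f).

(** By [horner_cubic_num] and [horner_cubic_den], the cubic map g/h sends
uncayley z to uncayley (z^3), and h does not vanish at uncayley z. *)
Lemma root_transform n (f : {poly F}) z : (size f <= n.+1)%N -> z ^+ 3 != 1 ->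
  root (T n f)^i (uncayley z) = root f^i (uncayley (z ^+ 3)).
Proof.
move=> sf z31; have z1 : z != 1 by apply: contraNneq z31 => ->; rewrite expr1n.
have z1' : 1 - z != 0 by rewrite subr_eq0 eq_sym.
have z31' : 1 - z ^+ 3 != 0 by rewrite subr_eq0 eq_sym.
have h0 := z31; rewrite -(cubic_den_neq0 z1) in h0.
rewrite /root map_ratsubst horner_ratsubst ?size_map_poly //.
rewrite mulf_eq0 expf_eq0 (negPf h0) andbF /=; congr (_.[_] == 0).
rewrite horner_cubic_num // horner_cubic_den // /uncayley; field.
by rewrite z1' z31' four_neq0 tau_neq0.
Qed.

(** Taking the cube root [z] of z^3 triples the period [n] under z |-> z^(-q).
By [frob_uncayley] and [root_transform] these are the coordinates of the roots
of the irreducible transforms of irreducible polynomials of degree [n]. *)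
Definition triples (n : nat) (z : K) :=
  has_period phi n (z ^+ 3) && has_period phi (3 * n) z.

Lemma triples_nontriv n z : (1 < n)%N -> triples n z -> z != 0 /\ z ^+ 3 != 1.
Proof.
move=> n1 /andP[h3 hz]; split.
  apply: contraTneq hz => ->; apply/negP => /has_period_dvd => /(_ 1%N).
  by rewrite /= phi0 eqxx dvdn1; lia.
apply: contraTneq h3 => ->; apply/negP => /has_period_dvd => /(_ 1%N).
by rewrite /= phi1 eqxx dvdn1; lia.
Qed.

Lemma exp3_neq1 (z : K) : z ^+ 3 != 1 -> z != 1.
Proof. by apply: contraNneq => ->; rewrite expr1n. Qed.

(** The transform of [f] is irreducible of degree 3n, so its roots are one
Frobenius orbit of that length; in the new coordinate this is one orbit of
z |-> z^(-q), and it is exactly the set of the [z] counted here. The list [R]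
replaces the infinite field by a finite set in which to count. *)
Lemma count_fiber n (f : {poly F}) (R : seq K) : (1 < n)%N ->
  f \is monic -> size f = n.+1 -> irreducible_poly f ->
  irreducible_poly (T n f) -> uniq R -> (forall z, triples n z -> z \in R) ->
  count (fun z => triples n z && root f^i (uncayley (z ^+ 3))) R = (3 * n)%N.
Proof.
move=> n1 mf sf irf irT uR inR.
have sT := size_ratsubst_cubic sigma mf sf.
have [x Tx] : exists x, root (T n f)^i x by apply: ex_root_map; rewrite sT; lia.
have [d hd [sd rootT]] := irr_orbit_poly irT Tx.
have {sd} Ed : d = (3 * n)%N by move: sd; rewrite sT => -[].
rewrite {d}Ed in hd rootT.
have hx : (cubic_den sigma)^i.[x] != 0.
  apply/negP => /eqP hx; move: (Tx).
  rewrite /root map_ratsubst horner_ratsubst_pole //.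
  have -> : (f^i)`_n = 1.
    rewrite coef_map /=; move/monicP: mf; rewrite lead_coefE sf /= => ->.
    by rewrite rmorph1.
  rewrite mul1r expf_eq0 => /andP[_ gx].
  have : coprimep (cubic_num sigma)^i (cubic_den sigma)^i.
    rewrite coprimep_map coprimep_cubic //.
      by rewrite -(fmorph_eq0 iota) rmorph_nat.
    by rewrite -(fmorph_eq0 iota) -tau2 expf_neq0 // tau_neq0.
  by move/coprimep_root => /(_ x gx); rewrite hx eqxx.
(* tau and - tau have Frobenius period 2, which is not divisible by 3n. *)
have xtau : (x != tau) /\ (x != - tau).
  have N2 : iter 2 frob x != x by rewrite (has_period_dvd _ hd) gtnNdvd //; lia.
  have fN : frob (- tau) = tau.
    rewrite -[- tau]sub0r (frob_is_zmod_morphism iota) frob_tau opprK.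
    by rewrite /frobenius expr0n gtn_eqF ?card_field_gt0 // add0r.
  by split; apply: contraNneq N2 => ->; rewrite /= ?(fN, frob_tau).
set z0 := (x - tau) / (x + tau).
have Ex : uncayley z0 = x by rewrite uncayleyK //; case: xtau.
have z00 : z0 != 0.
  by rewrite mulf_neq0 ?invr_eq0 ?subr_eq0 ?addr_eq0; case: xtau.
have z01 : z0 != 1.
  have xt : x + tau != 0 by rewrite addr_eq0; case: xtau.
  rewrite -(inj_eq (mulIf xt)) divfK // mul1r -subr_eq0.
  have -> : x - tau - (x + tau) = - (2%:R * tau) by ring.
  by rewrite oppr_eq0 mulf_neq0 ?tau_neq0.
have z031 : z0 ^+ 3 != 1 by rewrite -cubic_den_neq0 // Ex.
have z030 : z0 ^+ 3 != 0 by rewrite expf_neq0.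
have hz0 : has_period phi (3 * n) z0 by rewrite -has_period_uncayley // Ex.
have f0 : root f^i (uncayley (z0 ^+ 3)) by rewrite -(@root_transform n) ?Ex ?sf.
have hz03 : has_period phi n (z0 ^+ 3).
  have [d hd' [sd _]] := irr_orbit_poly irf f0.
  by move: sd hd'; rewrite sf => -[->]; rewrite has_period_uncayley.
rewrite -size_filter -(size_traject phi z0 (3 * n)); apply: perm_size.
apply: uniq_perm; rewrite ?filter_uniq ?(traject_uniq phi_inj) // => z.
rewrite mem_filter; apply/idP/trajectP => [/andP[/andP[Ez fz] _]|[i i3 ->]].
  have [zn0 z31] := triples_nontriv n1 Ez.
  move: fz; rewrite -(@root_transform n) ?sf // rootT => /trajectP[i i3].
  rewrite -Ex -iter_uncayley // => /uncayley_inj -> //; first by exists i.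
    exact: exp3_neq1.
  by rewrite iter_phi_eq ?phi1.
have Ei : triples n (iter i phi z0).
  by rewrite /triples -iter_phiX !(has_period_iter _ _ _ phi_inj) hz03.
by rewrite Ei inR // andbT -iter_phiX iter_uncayley // root_iter_frob.
Qed.

(** The polynomial is that of the Frobenius orbit of uncayley (z^3). *)
Lemma triples_unique n z : (1 < n)%N -> triples n z ->
  exists2 f : {poly_(n.+1) F},
    f \in irr_transforms (cubic_num sigma) (cubic_den sigma) n &
    forall g, g \in irr_transforms (cubic_num sigma) (cubic_den sigma) n ->
      root (polyn g)^i (uncayley (z ^+ 3)) = (g == f).
Proof.
move=> n1 Ez; have [zn0 z31] := triples_nontriv n1 Ez.
have z30 : z ^+ 3 != 0 by rewrite expf_neq0.
have [h3 h] := andP Ez.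
have h3' : has_period frob n (uncayley (z ^+ 3)) by rewrite has_period_uncayley.
have h' : has_period frob (3 * n) (uncayley z).
  by rewrite has_period_uncayley // exp3_neq1.
have [f Ef] := orbit_poly iota h3'.
have [mf sf irf] := orbit_poly_irr h3' Ef.
have fz := root_orbit_poly h3' Ef.
have Ef' : polyn (npolyp n.+1 f) = f by rewrite npolypK // sf.
exists (npolyp n.+1 f).
  rewrite inE Ef' mf sf eqxx /=; apply/andP; split; apply/irreducibleP => //.
  apply: (@irr_of_period _ _ iota _ _ _ (size_ratsubst_cubic sigma mf sf) _ h').
  by rewrite root_transform ?sf.
move=> g; rewrite inE => /and4P[mg /eqP sg /irreducibleP irg _].
apply/idP/eqP => [gz|->]; last by rewrite Ef'.
apply: val_inj; apply/eqP; rewrite /= Ef' -eqp_monic //.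
by apply/andP; split; [apply: irr_dvdp_root irg gz fz|apply: irr_dvdp_root irf fz gz].
Qed.

(** Double counting of the pairs (f, z) with uncayley (z^3) a root of f. *)
Lemma count_triples n (R : seq K) : (1 < n)%N -> uniq R ->
  (forall z, triples n z -> z \in R) ->
  count (triples n) R =
  (3 * n * #|irr_transforms (cubic_num sigma) (cubic_den sigma) n|)%N.
Proof.
move=> n1 uR inR; set I := irr_transforms _ _ _.
transitivity (\sum_(f in I)
    count (fun z => triples n z && root (polyn f)^i (uncayley (z ^+ 3))) R)%N.
  rewrite -sum1_count big_mkcond /=.
  under [RHS]eq_bigr do rewrite -sum1_count big_mkcond /=.
  rewrite exchange_big /=; apply: eq_bigr => z _.
  case: (boolP (triples n z)) => [Ez|_] /=; last by rewrite big1.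
  have [f fI uf] := triples_unique n1 Ez.
  rewrite (bigD1 f) //= uf // eqxx big1 // => g /andP[gI gf].
  by rewrite uf // (negPf gf).
rewrite mulnC -sum_nat_const; apply: eq_bigr => f.
rewrite inE => /and4P[mf /eqP sf /irreducibleP irf /irreducibleP irT].
exact: count_fiber.
Qed.

End Cayley.

(** * Counting roots of unity *)
Section UnityRoots.
Variable K : closedFieldType.

Lemma ex_unity_roots k : k%:R != 0 :> K ->
  exists rs : seq K,
    [/\ uniq rs, size rs = k & forall z, (z \in rs) = (z ^+ k == 1)].
Proof.
move=> k0; have kp : (0 < k)%N by case: k k0 => //; rewrite eqxx.
have [rs] := closed_field_poly_normal ('X^k - 1 : {poly K}).
rewrite (monicP _) ?monicXnsubC // scale1r => E; exists rs; split.
- by rewrite -separable_prod_XsubC -E separable_Xn_sub_1.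
- have := congr1 (fun p : {poly K} => size p) E.
  by rewrite size_prod_XsubC size_XnsubC // => -[].
by move=> z; rewrite -root_prod_XsubC -E /root hornerD hornerN hornerC hornerXn subr_eq0.
Qed.

Lemma count_unity_roots k (R : seq K) : k%:R != 0 :> K -> uniq R ->
  (forall z, z ^+ k = 1 -> z \in R) -> count (fun z => z ^+ k == 1) R = k.
Proof.
move=> k0 uR inR; have [rs [urs srs mem]] := ex_unity_roots k0.
rewrite -[RHS]srs -size_filter; apply: perm_size.
apply: uniq_perm; rewrite ?filter_uniq // => z.
rewrite mem_filter mem; case: eqP => //= /inR ->. by [].
Qed.

Lemma cube_root_dvd (w : K) j : w ^+ 3 = 1 -> w != 1 -> (w ^+ j == 1) = (3 %| j)%N.
Proof.
move=> w3 w1; rewrite {1}(divn_eq j 3) exprD mulnC exprM w3 expr1n mul1r /dvdn.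
have : (j %% 3 < 3)%N by rewrite ltn_mod.
case: (j %% 3)%N => [|[|[|//]]] _; rewrite ?expr0 ?eqxx ?(negPf w1) //.
by apply/negP => /eqP w2; case/eqP: w1; rewrite -w3 exprSr w2 mul1r.
Qed.

End UnityRoots.

(** * The sieve *)
Section Lifted.
Variables (F : finFieldType) (K : closedFieldType) (iota : {rmorphism F -> K}).
Notation q := #|F|.
Notation phi := (@twisted_frob F K).
Notation triples := (@triples F K).

Lemma card_field_eq0 : q%:R = 0 :> K.
Proof.
have q1 : (1 < q)%N := finNzRing_gt1 F.
have := pnatPpi (pchar_nat_card iota) (etrans (pi_pdiv q) q1).
by move=> /dvdn_pcharf E; apply/eqP; rewrite -E pdiv_dvd.
Qed.

Lemma iter_phi n z : 
  iter n phi z = if odd n then (z ^+ (q ^ n))^-1 else z ^+ (q ^ n).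
Proof.
elim: n => [|n IH]; first by rewrite expr1.
rewrite iterS IH /twisted_frob /frobenius /= expnSr.
by case: (odd n) => /=; rewrite ?exprVn ?invrK -exprM.
Qed.

(** q^n - (-1)^n, the order of the group of the z <> 0 with z^((-q)^n) = z. *)
Definition torus_order n := if odd n then (q ^ n).+1 else (q ^ n).-1.

Lemma iter_phi_fixed n z : z != 0 ->
  (iter n phi z == z) = (z ^+ torus_order n == 1).
Proof.
move=> z0; have zq : z ^+ (q ^ n) != 0 by rewrite expf_neq0.
rewrite iter_phi /torus_order; case: (odd n).
  by rewrite -(inj_eq (mulfI zq)) mulfV // -exprSr eq_sym.
have q0 : (0 < q ^ n)%N by rewrite expn_gt0 card_field_gt0.
by rewrite -{1}(prednK q0) exprSr -{3}[z]mul1r (inj_eq (mulIf z0)).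
Qed.

Lemma torus_order_int n : (torus_order n)%:Z = q%:Z ^+ n - (-1) ^+ n.
Proof.
have q0 : (0 < q ^ n)%N by rewrite expn_gt0 card_field_gt0.
rewrite /torus_order -signr_odd; case: (odd n); rewrite ?expr1 ?expr0 ?opprK.
  by rewrite -addn1 PoszD -!natz natrX.
by rewrite -subn1 -subzn // -!natz natrX.
Qed.

(** It is 1 or -1 modulo the characteristic; hence the polynomial
X^(torus_order n) - 1 is separable. *)
Lemma torus_order_neq0 n : (0 < n)%N -> (torus_order n)%:R != 0 :> K.
Proof.
move=> n0; rewrite -[_%:R]/((torus_order n)%:Z%:~R) torus_order_int.
rewrite rmorphB rmorphXn rmorph_sign /= -[_%:~R]/(q%:R) card_field_eq0 expr0n.
by rewrite gtn_eqF // sub0r oppr_eq0 signr_eq0.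
Qed.

Definition newly_fixed k (z : K) :=
  (iter k phi (z ^+ 3) == z ^+ 3) && (iter k phi z != z).

Lemma newly_fixedE k z : (0 < k)%N -> newly_fixed k z =
  (z ^+ (3 * torus_order k) == 1) && ~~ (z ^+ torus_order k == 1).
Proof.
move=> k0; rewrite /newly_fixed; case: (eqVneq z 0) => [->|z0].
  have t0 : (0 < torus_order k)%N.
    by rewrite lt0n; apply: contraNneq (torus_order_neq0 k0) => ->.
  rewrite expr0n /= [X in _ && ~~ X]iter_phi_eq ?phi0 // eqxx andbF.
  by rewrite expr0n muln_eq0 /= gtn_eqF // eq_sym oner_eq0.
by rewrite !iter_phi_fixed ?expf_neq0 // -exprM.
Qed.

Lemma count_newly_fixed k (R : seq K) : (0 < k)%N -> 3%:R != 0 :> K -> uniq R ->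
  (forall z, z ^+ (3 * torus_order k) = 1 -> z \in R) ->
  count (newly_fixed k) R = (2 * torus_order k)%N.
Proof.
move=> k0 three0 uR inR; have t0 := torus_order_neq0 k0.
rewrite (eq_count (fun z => newly_fixedE z k0)).
have c1 := @count_unity_roots _ (torus_order k) R t0 uR.
have c3 := @count_unity_roots _ (3 * torus_order k)%N R.
rewrite natrM mulf_neq0 // in c3; have {}c3 := c3 isT uR inR.
have {}c1 : count (fun z => z ^+ torus_order k == 1) R = torus_order k.
  by apply: c1 => z z1; apply: inR; rewrite mulnC exprM z1 expr1n.
set a := (fun z => z ^+ torus_order k == 1) in c1 *.
set b := (fun z => z ^+ (3 * torus_order k) == 1) in c3 *.
have ab : count a (filter b R) = count a R.
  rewrite count_filter; apply: eq_count => z /=; rewrite /a /b.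
  by case: eqP => // z1; rewrite mulnC exprM z1 expr1n eqxx.
have nab : count (predC a) (filter b R) = count (fun z => b z && ~~ a z) R.
  by rewrite count_filter; apply: eq_count => z /=; rewrite andbC.
have := count_predC a (filter b R); rewrite ab nab size_filter c3 c1 => E.
by apply: (@addnI (torus_order k)); rewrite -mulSn; exact: E.
Qed.

Variable s : nat.
(** [s] is the order of z |-> z^(-q) on the cube roots of unity, that is, the
order of - q modulo 3. *)
Definition acts_on_cube_roots := 
  (s = 1%N /\ forall w : K, w ^+ 3 = 1 -> phi w = w) \/
  (s = 2%N /\ forall w : K, w ^+ 3 = 1 -> phi w = w^-1).
Hypothesis sP : acts_on_cube_roots.

(** With d the period of z^3 and phi^d z = w z, w a cube root of unity: w <> 1,
since z is not fixed by phi^k. If phi^d inverts w then phi^(2d) z = z, and 2d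
divides k because d is odd and k even, which is excluded. So phi^d fixes w,
phi^(jd) z = w^j z for all j, and everything follows. *)
Lemma newly_fixed_triples k z : (s %| k)%N -> (0 < k)%N -> newly_fixed k z ->
  exists2 d, triples d z & [/\ (d %| k)%N, ~~ (3 %| k %/ d)%N & (s %| d)%N].
Proof.
move=> sk k0 /andP[/eqP k3 kz].
have z0 : z != 0 by apply: contraNneq kz => ->; rewrite iter_phi_eq ?phi0.
have [d h3] := ex_has_period k0 k3.
have d0 := has_period_gt0 h3.
have dk : (d %| k)%N by rewrite -(has_period_dvd _ h3) k3.
pose w := iter d phi z / z.
have dz : iter d phi z = w * z by rewrite divfK.
have w3 : w ^+ 3 = 1.
  rewrite expr_div_n -iter_phiX; have /eqP -> : iter d phi (z ^+ 3) == z ^+ 3.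
    by rewrite (has_period_dvd _ h3).
  by rewrite divff // expf_neq0.
have w0 : w != 0.
  by apply: contra_eq_neq w3 => ->; rewrite expr0n /= eq_sym oner_eq0.
have w1 : w != 1.
  apply: contraNneq kz => w1; rewrite -(divnK dk) iter_fix_mul //.
  by rewrite dz w1 mul1r.
have sd : (s %| d)%N.
  case: sP => [[-> _]|[s2 inv]]; first exact: dvd1n.
  rewrite s2 in sk *; rewrite dvdn2; apply/negP => oddd.
  have dw : iter d phi w = w^-1.
    have H j : iter j phi w = if odd j then w^-1 else w.
      elim: j => //= j ->; case: (odd j) => /=; rewrite inv ?invrK //.
      by rewrite exprVn w3 invr1.
    by rewrite H oddd.
  have dd : iter (2 * d) phi z = z.
    by rewrite mul2n -addnn iterD dz iter_phiM dw dz mulKf.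
  have d2k : (2 * d %| k)%N.
    by rewrite Gauss_dvd ?sk //= coprime2n oddd.
  by case/eqP: kz; rewrite -(divnK d2k) iter_fix_mul.
have dw : iter d phi w = w.
  case: sP sd => [[_ fix1]|[-> inv]] sd.
    by rewrite -[d]muln1 iter_fix_mul //= fix1.
  rewrite -(divnK sd) iter_fix_mul //= inv // inv ?invrK //.
  by rewrite exprVn w3 invr1.
have jd j : iter (j * d) phi z = w ^+ j * z.
  elim: j => [|j IH]; first by rewrite mul0n mul1r.
  rewrite mulSn iterD IH iter_phiM iter_phiX dw dz mulrA -exprSr //.
have kd j : (iter (j * d) phi z == z) = (3 %| j)%N.
  by rewrite jd -{2}[z]mul1r (inj_eq (mulIf z0)) cube_root_dvd.
exists d; last by split=> //; rewrite -kd divnK.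
rewrite /triples h3 /=; apply/has_periodP => [|m]; first by rewrite muln_gt0 d0.
case: (boolP (d %| m)%N) => [/dvdnP[j ->]|dm].
  by rewrite kd dvdn_pmul2r.
rewrite [RHS](contraNF _ dm); last by apply: dvdn_trans; rewrite dvdn_mull.
apply: contraNF dm => /eqP mz; rewrite -(has_period_dvd _ h3) iter_phiX mz //.
Qed.

(** If d0 is the period of z^3, then 3 does not divide s 3^a e / d0, so 3^a
divides d0, and so does s: the periods that occur are the s 3^a d. Conversely
3 s 3^a d cannot divide s 3^a e as e is prime to 3. *)
Lemma sum_triples a e z : (0 < e)%N -> ~~ (3 %| e)%N ->
  (\sum_(d <- divisors e) triples (s * 3 ^ a * d) z)%N =
  newly_fixed (s * 3 ^ a * e) z.
Proof.
move=> e0 e3; set n' := (s * 3 ^ a)%N.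
have s0 : (0 < s)%N by case: sP => -[-> _].
have n'0 : (0 < n')%N by rewrite muln_gt0 s0 expn_gt0.
have lc d : (d %| e)%N -> triples (n' * d) z -> newly_fixed (n' * e) z.
  move=> de /andP[h3 h]; rewrite /newly_fixed.
  rewrite (has_period_dvd _ h3) (has_period_dvd _ h).
  rewrite mulnCA !dvdn_pmul2l // de /=.
  by apply: contra e3; apply: dvdn_trans; rewrite dvdn_mulr.
case: (boolP (newly_fixed _ _)) => [|nc]; last first.
  rewrite big1_seq // => d; rewrite -dvdn_divisors // => de.
  by apply/eqP; rewrite eqb0; apply: contra nc; apply: lc.
case/newly_fixed_triples => [||d0 l0 [d0k k3 sd0]].
- by rewrite /n' -mulnA dvdn_mulr.
- by rewrite muln_gt0 n'0.
have n'd0 : (n' %| d0)%N.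
  rewrite Gauss_dvd ?sd0 /=; last first.
    by case: sP => -[-> _]; rewrite ?coprime1n // coprimeXr.
  have : (3 ^ a %| n' * e %/ d0 * d0)%N by rewrite divnK // /n' mulnAC dvdn_mull.
  by rewrite Gauss_dvdr // coprimeXl // prime_coprime.
have [d Ed] := dvdnP n'd0; rewrite mulnC in Ed.
have de : (d %| e)%N by move: d0k; rewrite Ed dvdn_pmul2l.
rewrite (bigD1_seq d) ?divisors_uniq -?dvdn_divisors //= -Ed l0.
rewrite big1 // => d' dd'; apply/eqP; rewrite eqb0; apply/negP => l'.
have := has_period_uniq (proj1 (andP l0)) (proj1 (andP l')).
by rewrite Ed => /eqP; rewrite eqn_pmul2l // eq_sym (negPf dd').
Qed.

(** The list [R] consists of the roots of unity of order dividing 3 (q^n -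
(-1)^n); it contains the points needed for every divisor of [n] of the form
s 3^a e. *)
Lemma moebius_triples a m (n := (s * 3 ^ a * m)%N) : (0 < m)%N ->
  ~~ (3 %| m)%N -> 3%:R != 0 :> K ->
  exists R : seq K, [/\ uniq R, forall z, triples n z -> z \in R &
   (count (triples n) R)%:Z = \sum_(d <- divisors m)
      moebius d * (2 * torus_order (s * 3 ^ a * (m %/ d)))%N%:Z].
Proof.
move=> m0 m3 three0.
have n'0 : (0 < s * 3 ^ a)%N.
  by rewrite muln_gt0 expn_gt0 andbT; case: sP => -[-> _].
have n0 : (0 < n)%N by rewrite muln_gt0 n'0.
have t0 : (3 * torus_order n)%:R != 0 :> K.
  by rewrite natrM mulf_neq0 // torus_order_neq0.
have [R [uR _ memR]] := ex_unity_roots t0.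
have fixR z : z != 0 -> iter n phi (z ^+ 3) = z ^+ 3 -> z \in R.
  by move=> z0 fz; rewrite memR exprM -iter_phi_fixed ?expf_neq0 // fz.
exists R; split=> // [z /andP[h3 h]|].
  apply: fixR; last by apply/eqP; rewrite (has_period_dvd _ h3).
  apply: contraTneq h => ->; apply/negP => /has_period_dvd => /(_ 1%N).
  by rewrite /= phi0 eqxx dvdn1; lia.
apply: (moebius_inversion (a := fun d => (count (triples (s * 3 ^ a * d)) R)%:Z)
  (G := fun e => (2 * torus_order (s * 3 ^ a * e))%N%:Z)) => // e em.
have e0 := dvdn_gt0 m0 em.
have e3 : ~~ (3 %| e)%N by apply: contra m3 => /dvdn_trans; apply.
have k0 : (0 < s * 3 ^ a * e)%N by rewrite muln_gt0 n'0.
rewrite -(@count_newly_fixed _ R) //; last first.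
  move=> z z1; have z0 : z != 0.
    apply: contra_eq_neq z1 => ->; rewrite expr0n muln_eq0 /= gtn_eqF.
      by rewrite eq_sym oner_eq0.
    by rewrite lt0n; apply: contraNneq (torus_order_neq0 k0) => ->.
  apply: fixR => //; rewrite /n -(divnK em) mulnCA iter_fix_mul //.
  by apply/eqP; rewrite iter_phi_fixed ?expf_neq0 // -exprM z1.
rewrite -[RHS](big_morph Posz PoszD (erefl _)) -sum1_count big_mkcond /=.
congr Posz; under [RHS]eq_bigr do rewrite -sum1_count big_mkcond /=.
rewrite exchange_big /=; apply: eq_bigr => z _.
transitivity (newly_fixed (s * 3 ^ a * e) z : nat); first by case: ifP.
by rewrite -sum_triples //; apply: eq_bigr => d _; case: (triples _ _).
Qed.

End Lifted.

(** * The number of irreducible transforms *)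
Section Count.
Variables (F : finFieldType) (K : closedFieldType) (iota : {rmorphism F -> K}).
Variables (sigma : F) (tau : K) (s : nat).
Hypotheses (tau2 : tau ^+ 2 = iota sigma) (two_neq0 : 2%:R != 0 :> K).
Hypothesis three_neq0 : 3%:R != 0 :> K.
Hypothesis sigma_nsq : ~ exists y : F, y ^+ 2 = sigma.
Hypothesis sP : acts_on_cube_roots F K s.
Notation q := #|F|.
Notation N n := #|irr_transforms (cubic_num sigma) (cubic_den sigma) n|.

(** Since 3n does not divide s n, the point [z] is not fixed by phi^(s n) while
z^3 is, so [newly_fixed_triples] applies. *)
Lemma triples_dvd n (z : K) : triples F n z -> (s %| n)%N.
Proof.
move=> ln; have [h3 h] := andP ln; have n0 := has_period_gt0 h3.
have s0 : (0 < s)%N by case: sP => -[-> _].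
have sn0 : (0 < s * n)%N by rewrite muln_gt0 s0.
have cf : newly_fixed F (s * n) z.
  rewrite /newly_fixed (has_period_dvd _ h3) (has_period_dvd _ h) dvdn_mull //=.
  by rewrite dvdn_pmul2r //; case: sP => -[-> _].
have [d /andP[h3' _] [_ _ sd]] :=
  newly_fixed_triples iota sP (dvdn_mulr n (dvdnn s)) sn0 cf.
by rewrite (has_period_uniq h3 h3').
Qed.

Lemma card_transforms_eq0 n : (1 < n)%N -> ~~ (s %| n)%N -> N n = 0%N.
Proof.
move=> n1 sn; have := @count_triples _ _ _ _ _ tau2 two_neq0 sigma_nsq n [::] n1 isT.
move=> H; have /esym/eqP : 0%N = (3 * n * N n)%N.
  by apply: H => z /triples_dvd; rewrite (negPf sn).
by rewrite !muln_eq0 /= => /orP[/eqP n0|/eqP //]; rewrite n0 in n1.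
Qed.

Lemma necklaceE m Q : (0 < m)%N -> necklace m%:R Q =
  m%:R^-1 * \sum_(d <- divisors m) (moebius d * Q ^+ (m %/ d))%:~R.
Proof. by move=> m0; rewrite /necklace natr_nat ltr0n m0 /= natrK. Qed.

Lemma card_transforms a m : (0 < m)%N -> ~~ (3 %| m)%N ->
    (1 < s * 3 ^ a * m)%N ->
  (N (s * 3 ^ a * m))%:R = 2%:R / (3%:R * (s * 3 ^ a)%:R) *
    (necklace m%:R (q%:Z ^+ (s * 3 ^ a)) - necklace m%:R ((-1) ^+ (s * 3 ^ a))).
Proof.
move=> m0 m3; set k := (s * 3 ^ a)%N => n1.
have [R [uR inR]] := moebius_triples iota sP a m0 m3 three_neq0; rewrite -/k.
rewrite (count_triples tau2 two_neq0 sigma_nsq n1 uR inR) => E.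
have k0 : k%:R != 0 :> rat by rewrite pnatr_eq0; apply: contraTneq n1 => ->.
have m0' : m%:R != 0 :> rat by rewrite pnatr_eq0 -lt0n.
have {}E : (3%:R * (k%:R * m%:R) * (N (k * m))%:R : rat) =
    2%:R * \sum_(d <- divisors m) (moebius d * (q%:Z ^+ k) ^+ (m %/ d) -
       moebius d * ((-1) ^+ k) ^+ (m %/ d))%:~R.
  rewrite -!natrM -[LHS]/((_%N%:Z)%:~R) E rmorph_sum mulr_sumr.
  apply: eq_bigr => d _; rewrite -mulrBr !rmorphM /= mulrCA; congr (_ * _).
  by rewrite PoszM torus_order_int -!exprM rmorphM.
rewrite !necklaceE // -mulrBr -sumrB.
under [X in _ = _ * (_ * X)]eq_bigr do rewrite -rmorphB.
move: (\sum_(_ <- _) _) E => S E.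
apply: (mulfI (x := 3%:R * (k%:R * m%:R))); first by rewrite !mulf_neq0.
by rewrite E; field; rewrite m0' k0.
Qed.

End Count.

(** On cube roots of unity the exponent - q only matters modulo 3. *)
Lemma acts_on_cube_rootsP (F : finFieldType) (K : closedFieldType) :
  (#|F| %% 3 = 2 -> acts_on_cube_roots F K 1)%N /\
  (#|F| %% 3 = 1 -> acts_on_cube_roots F K 2)%N.
Proof.
have E (w : K) : w ^+ 3 = 1 -> w ^+ #|F| = w ^+ (#|F| %% 3).
  by move=> w3; rewrite {1}(divn_eq #|F| 3) exprD mulnC exprM w3 expr1n mul1r.
split=> q3; [left|right]; split=> // w w3; rewrite /twisted_frob /frobenius E // q3 //.
have w0 : w != 0.
  by apply: contra_eq_neq w3 => ->; rewrite expr0n /= eq_sym oner_eq0.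
by apply: (mulfI (expf_neq0 2 w0)); rewrite mulfV ?expf_neq0 // -exprSr w3.
Qed.

Theorem theorem11 (F : finFieldType) (p : nat) (sigma : F) (n : nat)
    (charF : p \in [pchar F]) (p_ge5 : (5 <= p)%N)
    (sigma_nonsquare : ~ exists y : F, y ^+ 2 = sigma) (n_gt1 : (1 < n)%N) :
  let q := #|F| in
  let n3 := (n`_3)%N in
  let N := #|irr_transforms (cubic_num sigma) (cubic_den sigma) n| in
  ((q = 1 %[mod 3])%Z ->
     N%:R = 1 / (3%:R * n3%:R) *
       (necklace (n%:R / (2%:R * n3%:R)) (q%:Z ^+ (2 * n3))
        - necklace (n%:R / (2%:R * n3%:R)) 1)) /\
  ((q = -1 %[mod 3])%Z ->
     N%:R = 2%:R / (3%:R * n3%:R) *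
       (necklace (n%:R / n3%:R) (q%:Z ^+ n3)
        - necklace (n%:R / n3%:R) (-1))).
Proof.
move=> q n3 N; rewrite {}/q {}/N.
have [K [iota _]] := countable_algebraic_closure F.
have [tau tau2] : exists tau : K, tau ^+ 2 = iota sigma.
  have : size ('X^2 - (iota sigma)%:P) != 1%N by rewrite size_XnsubC.
  case/closed_rootP => t; rewrite /root hornerD hornerN hornerC hornerXn subr_eq0.
  by move=> /eqP tE; exists t.
have small k : (0 < k < 5)%N -> k%:R != 0 :> K.
  move=> k5; rewrite -(dvdn_pcharf (rmorph_pchar iota charF)) gtnNdvd //; lia.
have two0 := small 2%N isT; have three0 := small 3%N isT.
have n0 : (0 < n)%N by lia.
have [m m3 En] := pfactor_coprime (isT : prime 3) n0.
rewrite -p_part -/n3 in En.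
have m0 : (0 < m)%N by move: n0; rewrite En; case: (m).
rewrite prime_coprime // in m3.
have n30 : (n3%:R : rat) != 0.
  by rewrite pnatr_eq0; apply: contraTneq n0 => n30; rewrite En n30 muln0.
have E3 : n3 = (3 ^ logn 3 n)%N by rewrite /n3 p_part.
have [act2 act1] := acts_on_cube_rootsP F K.
split=> q3.
  have {}q3 : (#|F| %% 3 = 1)%N by lia.
  have sP := act1 q3; case: (boolP (2 %| n)%N) => [n2|n2]; last first.
    rewrite (card_transforms_eq0 tau2 two0 sigma_nonsquare sP) //.
    have nec Q : necklace (n%:R / (2%:R * n3%:R)) Q = 0.
      rewrite /necklace; case: ifP => // /andP[/natrP[k Ek] _].
      move/negP: n2; case; apply/dvdnP; exists (k * n3)%N; apply/eqP.
      have En2 : n%:R = k%:R * (2%:R * n3%:R) :> rat.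
        by rewrite -Ek divfK // mulf_neq0.
      by rewrite -(eqr_nat rat) En2 !natrM; apply/eqP; ring.
    by rewrite !nec subrr mulr0.
  have m2 : (2 %| m)%N.
    move: n2; rewrite En Gauss_dvdl // E3 coprimeXr //.
  have [k Ek] := dvdnP m2.
  have En' : n = (2 * 3 ^ logn 3 n * k)%N by rewrite -E3 En Ek; lia.
  have k0 : (0 < k)%N by move: m0; rewrite Ek; case: (k).
  have k3 : ~~ (3 %| k)%N by apply: contra m3 => k3; rewrite Ek dvdn_mulr.
  have := card_transforms (a := logn 3 n) tau2 two0 three0 sigma_nonsquare sP k0 k3.
  rewrite -En' => -> //.
  have -> : n%:R / (2%:R * n3%:R) = k%:R :> rat.
    by rewrite {1}En Ek !natrM; field.
  rewrite -E3 [(-1) ^+ _]exprM sqrrN !expr1n natrM; congr (_ * _).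
  by field.
have {}q3 : (#|F| %% 3 = 2)%N by lia.
have sP := act2 q3.
have En' : n = (1 * 3 ^ logn 3 n * m)%N by rewrite -E3 {1}En; lia.
have := card_transforms (a := logn 3 n) tau2 two0 three0 sigma_nonsquare sP m0 m3.
rewrite -En' => -> //.
have -> : n%:R / n3%:R = m%:R :> rat by rewrite {1}En natrM mulfK.
by rewrite mul1n -E3 -[(-1) ^+ n3]signr_odd E3 oddX orbT expr1.
Qed.
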